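(* Under the standing assumptions of the context, let $0\le i\le T-1$. Assume $C_G(P_i)\le P_i$ and that every automorphism of $G$ induced by a derivation in $\mathrm{Der}(G/P_i,\Omega_1(Z(P_i)))$ is inner. Then there exists an automorphism $\phi$ of $G$ of order $p$ such that $\phi$ fixes $P_{i+1}$ elementwise but does not fix $P_i$ elementwise.
   Context: Standing assumptions: $p$ is an odd prime; $G$ is a finite non-abelian $p$-group with cyclic center; $\Omega_1(Z(G))\le\gamma_3(G)G^p$ and $|\Phi(G)/\gamma_3(G)G^p|=p^T\ge p$. Fix normal subgroups $\gamma_3(G)G^p=P_T\le P_{T-1}\le\cdots\le P_1\le P_0=\Phi(G)$ with $|P_i/P_{i+1}|=p$. Here $\Omega_1(X)=\langle x:x^p=1\rangle$, $G^p=\langle g^p\rangle$. $G/P_i$ acts on $\Omega_1(Z(P_i))$ by conjugation; $\mathrm{Der}(G/P_i,\Omega_1(Z(P_i)))$ is the set of maps $\delta:G\to\Omega_1(Z(P_i))$ with $\delta(xy)=\delta(x)^y\delta(y)$ and $\delta(P_i)=1$; the automorphism induced by such $\delta$ is $g\mapsto g\delta(g)$. *)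

(* Defs.v *)
From mathcomp Require Import all_boot all_fingroup all_solvable.
Set Implicit Arguments. Unset Strict Implicit. Unset Printing Implicit Defensive.
Local Open Scope group_scope.

(* A derivation of G/N into the G-module M (action by conjugation), pulled back
   to G: a map delta : G -> M with delta(xy) = delta(x)^y delta(y) and delta(N) = 1.
   Values outside G are irrelevant. *)
Definition is_derivation (gT : finGroupType) (G N M : {set gT}) (delta : gT -> gT) : Prop :=
  [/\ forall x, x \in G -> delta x \in M,
      forall x y, x \in G -> y \in G -> delta (x * y) = (delta x) ^ y * delta y
    & forall x, x \in N -> delta x = 1].

Definition induced_aut_inner (gT : finGroupType) (G : {set gT}) (delta : gT -> gT) : Prop :=
  exists2 h, h \in G & forall x, x \in G -> x * delta x = x ^ h.

(* Main.v *)
Require Import Defs.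
From mathcomp Require Import all_boot all_fingroup all_solvable.
Local Open Scope group_scope.

(* Write F for Phi(G) and Z for Omega_1(Z(G)), of order p. As F / P_{i+1} is
   elementary abelian and central in G / P_{i+1}, there is a G-invariant
   morphism lam : F -> Z killing P_{i+1} but not P_i. It is enough to extend
   y |-> y lam(y) to an endomorphism g |-> g d(g) of G with d(g) in an elementary
   abelian subgroup E of Z(P_i): its p-th power is then trivial because p is odd.
   The hypothesis on derivations is used only for morphisms G -> Z: each of them
   is a commutator map [-, h] with h in Z(P_i). These h form a group D with
   C_G(D) = F; let E = Omega_1(D). Since Z(G) is cyclic, C_G(E) / F has order at
   most p, so lam[g, g'] = 1 for g, g' in C_G(E), and therefore every
   lam[g, -] with g in C_G(E) is already [e, -] for some e in E.
   The graph of the extension is found inside the group X of the pairs (g, g e):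
   modulo the graph N of y |-> y lam(y), X has exponent p and its derived subgroup
   lies in the image of 1 x Z, and the centraliser of 1 x E in X / N is
   (1 x E) Z(X / N). A Lagrangian argument then provides a complement of 1 x E. *)

(** * Commutator pairings with values in a group of order p *)

(** Induction on the order of U. Replacing U by the centraliser in U of some v in V that does not
    centralise U costs an index of at most p, since the U-conjugates of v lie in the coset vZ. In
    exchange the centraliser in V gains v, hence a factor of at least p, as V is a p-group. *)
Lemma leq_index_subcent {p : nat} {gT : finGroupType} {U V Z : {group gT}} :
  prime p -> p.-group V -> #|Z| = p -> [~: U, V] \subset Z ->
  #|U : 'C_U(V)| <= #|V : 'C_V(U)|.
Proof.
move=> pr_p pV oZ; have [n] := ubnP #|U|; elim: n U => // n IHn U /ltnSE leUn sUVZ.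
have [cUV | ] := boolP (V \subset 'C(U)).
  by rewrite (setIidPl _) ?indexgg ?indexg_gt0 // centsC.
case/subsetPn=> v Vv not_cUv.
have sU1U: 'C_U[v] \subset U by rewrite subsetIl.
have prU1: #|'C_U[v]| < #|U|.
  rewrite proper_card // properE sU1U; apply: contra not_cUv => sUC.
  by rewrite -sub_cent1 (subset_trans sUC) ?subsetIr.
have eqC: 'C_('C_U[v])(V) = 'C_U(V).
  apply/eqP; rewrite eqEsubset setSI // subsetI subsetIr andbT.
  by rewrite setIS // -cent_set1 centS // sub1set.
have ltC: 'C_V(U) \proper 'C_V('C_U[v]).
  rewrite properE setIS ?centS //=; apply: contra not_cUv => sC.
  have: v \in 'C_V(U).
    by rewrite (subsetP sC) // inE Vv; apply/centP => x /setIP[_ /cent1P].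
  by case/setIP.
have leIH: #|'C_U[v] : 'C_U(V)| <= #|V : 'C_V('C_U[v])|.
  rewrite -eqC; apply: IHn; first exact: leq_trans prU1 leUn.
  exact: subset_trans (commSg _ sU1U) sUVZ.
have leUp: #|U : 'C_U[v]| <= p.
  rewrite index_cent1 -oZ -(card_lcoset Z v) subset_leq_card //.
  apply/subsetP=> _ /imsetP[u Uu ->]; rewrite conjg_mulR mem_lcoset mulKg.
  by rewrite (subsetP sUVZ) // commGC mem_commg.
have geVp: p <= #|'C_V('C_U[v]) : 'C_V(U)|.
  have pC: p.-group 'C_V('C_U[v]) by apply: pgroupS pV; apply: subsetIl.
  have [k ok] : exists k, #|'C_V('C_U[v]) : 'C_V(U)| = (p ^ k)%N.
    by have [k ->] := p_natP (pnat_dvd (dvdn_indexg _ 'C_V(U)) pC); exists k.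
  rewrite ok; case: k ok => [ok | k _].
    by case/negP: (proper_subn ltC); rewrite -indexg_eq1 ok.
  by rewrite expnS leq_pmulr // expn_gt0 prime_gt0.
rewrite -(Lagrange_index sU1U) ?subsetI ?subsetIl //=; last first.
  by rewrite -cent_set1 subIset // centS ?sub1set // orbT.
rewrite -(@Lagrange_index _ V 'C_V('C_U[v])%G 'C_V(U)%G) ?subsetIl ?(proper_sub ltC) //=.
by rewrite mulnC leq_mul // (leq_trans leUp).
Qed.

Lemma index_subcent {p : nat} {gT : finGroupType} {U V Z : {group gT}} :
  prime p -> p.-group U -> p.-group V -> #|Z| = p -> [~: U, V] \subset Z ->
  #|U : 'C_U(V)| = #|V : 'C_V(U)|.
Proof.
move=> pr_p pU pV oZ sUVZ; apply/eqP; rewrite eqn_leq.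
by rewrite !(leq_index_subcent pr_p _ oZ) // commGC.
Qed.

(** Both H / K and Z are cyclic of order p. This serves twice: for morphisms from G with a
    prescribed maximal subgroup as kernel, and for [lam] on Phi(G). *)
Lemma hom_of_index_p {p : nat} {gT : finGroupType} {H K Z : {group gT}} :
  prime p -> K <| H -> #|H : K| = p -> #|Z| = p ->
  exists f : gT -> gT,
    [/\ {in H &, {morph f : x y / x * y}}, {in H, forall x, f x \in Z}
      & {in H, forall x, (f x == 1) = (x \in K)}].
Proof.
move=> pr_p nsKH oHK oZ; have nKH := normal_norm nsKH.
have oq: #|H / K| = p by rewrite card_quotient.
have iso: (H / K)%G \isog Z.
  by rewrite isog_cyclic_card ?prime_cyclic ?oq ?oZ ?eqxx.
have [g injg img] := isogP iso.
exists (fun x => g (coset K x)); split=> [x y Hx Hy | x Hx | x Hx].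
- by rewrite morphM ?(subsetP nKH) // morphM ?mem_quotient.
- by rewrite -img mem_morphim ?mem_quotient.
have Kx: coset K x \in H / K by rewrite mem_quotient.
rewrite (morph_injm_eq1 injg) //.
by apply/eqP/idP; [apply: coset_idr; apply: (subsetP nKH) | apply: coset_id].
Qed.

(** * Complements of an abelian subgroup in a group of exponent p *)

(** The complement is a subgroup S maximal among those meeting M trivially and containing a suitable
    central S0. Maximality puts the centraliser of S inside SM, and the duality of indices shows
    that this centraliser and M together generate Y. *)
Lemma complement_class2 {p : nat} {gT : finGroupType} {Y M Z : {group gT}} :
  prime p -> (forall y, y \in Y -> y ^+ p = 1) ->
  abelian M -> M \subset Y -> Z \subset M -> #|Z| = p -> [~: Y, Y] \subset Z ->
  'C_Y(M) \subset M * 'Z(Y) ->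
  exists S : {group gT}, [/\ S \subset Y, S :&: M = 1 & S * M = Y].
Proof.
move=> pr_p expY cMM sMY sZM oZ sYYZ sCMZ.
have expYp: exponent Y %| p by apply/exponentP.
have pY: p.-group Y by rewrite -pnat_exponent (pnat_dvd expYp) ?pnat_id.
have abelZ: p.-abelem 'Z(Y).
  rewrite abelemE // center_abelian.
  exact: dvdn_trans (exponentS (center_sub Y)) expYp.
have sMZZ: M :&: 'Z(Y) \subset 'Z(Y) by rewrite subsetIr.
(* S0 is a complement of M :&: Z(Y) in Z(Y). Starting from it turns the centraliser hypothesis into
   ['C_Y(M) \subset M * S0], so that elements of S centralising M must lie in S0. *)
have := abelem_splits abelZ sMZZ; case/splitsP=> S0 /complP[tiMS0 defZY].
have sS0Z: S0 \subset 'Z(Y) by rewrite -defZY mulG_subr.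
have sS0Y: S0 \subset Y := subset_trans sS0Z (center_sub Y).
have tiS0M: S0 :&: M = 1.
  by rewrite -tiMS0 -{1}(setIidPl sS0Z) -setIA (setIC S0) (setIC 'Z(Y)).
have defMZ: M * 'Z(Y) = M * S0 by rewrite -defZY mulgA (mulGSid (subsetIl M _)).
pose good (H : {group gT}) := (H \subset Y) && (H :&: M == 1).
have good0: good S0 by rewrite /good sS0Y tiS0M eqxx.
have [S maxS sS0S] := maxgroup_exists good0.
have [/andP[sSY /eqP tiSM] maxS'] := maxgroupP maxS.
have nMY: Y \subset 'N(M).
  by rewrite -commg_subr (subset_trans _ sZM) // (subset_trans (commgS Y sMY)).
have defSM: S <*> M = S * M by rewrite norm_joinEl ?(subset_trans sSY).
(* An element y outside SM that centralises S has order p, so <y> meets SM trivially; then S<y>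
   still meets M trivially, against the maximality of S. *)
have sCSM: 'C_Y(S) \subset S * M.
  apply/subsetP=> y /setIP[Yy cSy]; apply: contraT => notSMy.
  have tiySM: <[y]> :&: (S <*> M) = 1.
    have [y1 | nty] := eqVneq y 1.
      by apply/trivgP; rewrite (subset_trans (subsetIl _ _)) //= y1 cycle1.
    have oy: prime #|<[y]>| by rewrite -orderE (nt_prime_order pr_p) ?expY.
    by apply: prime_TIg; rewrite //= cycle_subG /= defSM.
  have cSY: <[y]> \subset 'C(S) by rewrite cycle_subG.
  have defSy: S <*> <[y]> = S * <[y]> by rewrite cent_joinEr // centsC.
  have Sy: y \in S.
    rewrite -cycle_subG -(maxS' (S <*> <[y]>)%G) ?joing_subr ?joing_subl //.
    rewrite /good join_subG sSY cycle_subG Yy; apply/eqP/trivgP; rewrite /= defSy.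
    apply/subsetP=> _ /setIP[/mulsgP[s y' Ss yy' ->] Msy].
    have y'1: y' = 1.
      apply/set1gP; rewrite -tiySM inE yy' /= defSM -(mulKg s y').
      by rewrite mem_mulg ?groupV.
    by rewrite y'1 mulg1 in Msy *; rewrite -tiSM inE Ss.
  by case/negP: notSMy; rewrite -[y]mulg1 mem_mulg.
exists S; split=> //; apply/eqP; rewrite eqEsubset mul_subG //=.
(* Since 'C_S(M) is central in Y, M and Y induce equally many commutator maps
   on S, so that Y = M * 'C_Y(S), which maximality of S puts inside S * M. *)
have eqCS: 'C_S(M) = 'C_S(Y).
  apply/eqP; rewrite eqEsubset andbC setIS ?centS //= subsetI subsetIl.
  apply: subset_trans (subset_trans sS0Z (subsetIr _ _)).
  apply/subsetP=> s /setIP[Ss cMs].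
  have: s \in M * S0 by rewrite -defMZ (subsetP sCMZ) // inE (subsetP sSY).
  case/mulsgP=> m s0 Mm S0s0 defs.
  have m1: m = 1.
    apply/set1gP; rewrite -tiSM inE Mm andbT -(mulgK s0 m) -defs.
    by apply: groupM; rewrite ?groupV //; apply: (subsetP sS0S).
  by rewrite defs m1 mul1g.
have pS := pgroupS sSY pY; have pM := pgroupS sMY pY.
have eqi: #|M : 'C_M(S)| = #|Y : 'C_Y(S)|.
  rewrite (index_subcent pr_p pM pS oZ) ?(subset_trans (commgSS sMY sSY)) //.
  by rewrite (index_subcent pr_p pY pS oZ) ?(subset_trans (commgS Y sSY)) // eqCS.
have defY: M * 'C_Y(S) = Y.
  apply/eqP; rewrite eqEcard mul_subG ?subsetIl //=.
  have := mul_cardG M 'C_Y(S); rewrite setIA (setIidPl sMY) => eqMC.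
  rewrite -(leq_pmul2r (cardG_gt0 'C_M(S))) -eqMC.
  rewrite -(Lagrange (subsetIl Y 'C(S))) -eqi -mulnA (mulnC #|M : _|).
  by rewrite (Lagrange (subsetIl M 'C(S))) mulnC.
by rewrite -defSM -{1}defY mul_subG ?joing_subr //= defSM.
Qed.

(** * Extending the twist of F to an automorphism of G *)

(** The map is read off from a subgroup of pairs that projects bijectively onto G: the preimage of a
    complement given by [complement_class2]. The last hypothesis yields the centraliser condition
    needed there. *)
Lemma extend_twist {p : nat} {gT : finGroupType} {G F E Z : {group gT}}
    {lam : gT -> gT} :
  prime p -> odd p -> p.-abelem E -> #|Z| = p ->
  F \subset G -> E \subset F -> Z \subset E ->
  Z \subset 'C(G) -> E \subset 'C(F) -> [~: E, G] \subset Z ->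
  [~: G, G] \subset F ->
  {in F &, {morph lam : x y / x * y}} -> {in F, forall x, lam x \in Z} ->
  {in G & F, forall g x, lam (x ^ g) = lam x} ->
  {in G, forall g, g ^+ p \in F /\ lam (g ^+ p) = 1} ->
  {in 'C_G(E), forall g,
     exists2 e, e \in E & {in G, forall h, [~ e, h] = lam [~ g, h]}} ->
  exists phi : gT -> gT,
    [/\ {in G &, {morph phi : x y / x * y}},
        {in G, forall g, g^-1 * phi g \in E}
      & {in F, forall x, phi x = x * lam x}].
Proof.
move=> pr_p odd_p abelE oZ sFG sEF sZE cGZ cFE sEGZ sGGF lamM lamZ lamJ expG CGE.
have [pE cEE expE] := and3P abelE.
have sEG := subset_trans sEF sFG; have sZF := subset_trans sZE sEF.
have lam1 : lam 1 = 1.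
  by apply: (mulgI (lam 1)); rewrite -lamM ?group1 // !mulg1.
have nEG g : g \in G -> g \in 'N(E).
  move=> Gg; apply: (subsetP _ g Gg).
  by rewrite -commg_subl (subset_trans sEGZ).
have cZ z g : z \in Z -> g \in G -> commute z g.
  by move=> Zz Gg; apply: (centsP cGZ).
have cE e x : e \in E -> x \in F -> commute e x.
  by move=> Ee Fx; apply: (centsP cFE).
have R1 e x : e \in E -> x \in F -> [~ e, x] = 1.
  by move=> Ee Fx; apply/eqP/commgP/cE.
have FR g h : g \in G -> h \in G -> [~ g, h] \in F.
  by move=> Gg Gh; rewrite (subsetP sGGF) ?mem_commg.
have ZR e g : e \in E -> g \in G -> [~ e, g] \in Z.
  by move=> Ee Gg; rewrite (subsetP sEGZ) ?mem_commg.
(* All commutators lie in F, which E centralises, and E itself is abelian; so commutators of G are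
   additive in the factors taken from E. *)
have RE g h e f : g \in G -> h \in G -> e \in E -> f \in E ->
    [~ g * e, h * f] = [~ g, h] * ([~ g, f] * [~ e, h]).
  move=> Gg Gh Ee Ef; have [Ge Gf] := (subsetP sEG e Ee, subsetP sEG f Ef).
  have JE x c : c \in E -> x \in F -> x ^ c = x.
    by move=> Ec Fx; rewrite conjgE -(cE c) // mulKg.
  have Zgf : [~ g, f] \in Z by rewrite -invg_comm groupV ZR.
  have Fgh := FR g h Gg Gh; have Fgf := subsetP sZF _ Zgf.
  rewrite commMgJ !commgMJ (JE _ f Ef Fgh) (JE _ e Ee (groupM Fgf Fgh)).
  rewrite (R1 e f Ee (subsetP sEF f Ef)) mul1g.
  rewrite (JE _ f Ef (subsetP sZF _ (ZR e h Ee Gh))).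
  by rewrite (cZ _ _ Zgf (subsetP sFG _ Fgh)); exact: esym (mulgA _ _ _).
pose Xs := [set u : gT * gT | (u.1 \in G) && (u.1^-1 * u.2 \in E)].
have Xgroup : group_set Xs.
  apply/group_setP; split=> [|[g a] [h b]]; rewrite !inE /= ?invg1 ?mulg1 ?group1 //.
  move=> /andP[Gg Ea] /andP[Gh Eb]; rewrite groupM //=.
  have -> : (g * h)^-1 * (a * b) = (g^-1 * a) ^ h * (h^-1 * b).
    by rewrite conjgE invMg !mulgA mulgK.
  by rewrite groupM // memJ_norm ?nEG.
pose X := Group Xgroup.
have memX g e : g \in G -> e \in E -> (g, g * e) \in X.
  by move=> Gg Ee; rewrite inE /= Gg mulKg.
have XP u : u \in X -> exists g e, [/\ g \in G, e \in E & u = (g, g * e)].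
  case: u => g a; rewrite inE /= => /andP[Gg Ea].
  by exists g, (g^-1 * a); rewrite mulKVg.
pose Ns := [set u : gT * gT | (u.1 \in F) && (u.2 == u.1 * lam u.1)].
have Ngroup : group_set Ns.
  apply/group_setP; split=> [|[g a] [h b]]; rewrite !inE /= ?lam1 ?mulg1 ?group1 //=.
  move=> /andP[Fg /eqP->] /andP[Fh /eqP->]; rewrite groupM // lamM //=.
  have cgh : commute (lam g) h by apply: cZ; rewrite ?lamZ // (subsetP sFG).
  by rewrite -!mulgA (mulgA (lam g)) cgh -mulgA.
pose N := Group Ngroup.
have sNX : N \subset X.
  apply/subsetP=> -[g a]; rewrite !inE /= => /andP[Fg /eqP->].
  by rewrite (subsetP sFG) // mulKg (subsetP sZE) ?lamZ.
have nFG g x : g \in G -> x \in F -> x ^ g \in F.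
  move=> Gg Fx; rewrite conjg_mulR; apply: groupM => //; apply: FR => //.
  exact: (subsetP sFG).
have nNX : X \subset 'N(N).
  apply/subsetP=> u /XP[g [e [Gg Ee ->]]]; rewrite inE; apply/subsetP=> _ /imsetP[[x a] Nxa ->].
  move: Nxa; rewrite inE /= => /andP[Fx /eqP->].
  have -> : (x, x * lam x) ^ (g, g * e) = (x ^ g, (x * lam x) ^ (g * e)) by [].
  have Ge := subsetP sEG e Ee.
  rewrite inE /= nFG //= lamJ // conjMg (conjgM x) (conjgE (x ^ g)).
  rewrite -(cE e (x ^ g)) ?nFG // mulKg.
  by rewrite (conjgE (lam x)) (cZ (lam x)) ?lamZ ?groupM // mulKg.
have ZXR u v : u \in X -> v \in X ->
    exists2 z, z \in Z & [~ u, v] = ([~ u.1, v.1], [~ u.1, v.1] * z).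
  move=> /XP[g [e [Gg Ee ->]]] /XP[h [f [Gh Ef ->]]].
  have -> : [~ (g, g * e), (h, h * f)] = ([~ g, h], [~ g * e, h * f]) by [].
  exists ([~ g, f] * [~ e, h]); last by rewrite RE.
  by apply: groupM; last exact: ZR; rewrite -invg_comm groupV ZR.
(* Together with [ZXR] this places every commutator of X in N times the image of 1 x Z. *)
have lamNZ x z : x \in F -> z \in Z -> (x, x * z) \in N * (@pair1g gT gT @* Z).
  move=> Fx Zz; apply/mulsgP.
  exists (x, x * lam x) (@pair1g gT gT ((lam x)^-1 * z)).
  - by rewrite !inE /= Fx eqxx.
  - by rewrite mem_morphim ?inE // groupM ?groupV ?lamZ.
  - have -> : (x, x * lam x) * @pair1g gT gT ((lam x)^-1 * z)
        = (x * 1, x * lam x * ((lam x)^-1 * z)) by [].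
    by rewrite mulg1 -mulgA mulKVg.
pose M1 := (@pair1g gT gT @* E)%G; pose Z1 := (@pair1g gT gT @* Z)%G.
have sM1X : M1 \subset X.
  apply/subsetP=> _ /morphimP[e _ Ee ->]; rewrite inE /=.
  by rewrite group1 invg1 mul1g.
have sZM1 : Z1 \subset M1 by rewrite morphimS.
have tiNM1 : N :&: M1 = 1.
  apply/trivgP/subsetP=> u /setIP[Nu /morphimP[e _ Ee defu]].
  by move: Nu; rewrite defu !inE /= lam1 mulg1 => /andP[_ /eqP->].
have tiNZ1 : N :&: Z1 = 1.
  by apply/trivgP; rewrite -tiNM1 setIS.
have nNM1 := subset_trans sM1X nNX; have nNZ1 := subset_trans sZM1 nNM1.
have oZ1 : #|Z1 / N| = p.
  by rewrite -(card_isog (quotient_isog nNZ1 tiNZ1)) card_injm ?injm_pair1g ?subsetT.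
(* Here (ge)^p = g^p e^p [e,g]^(p choose 2), and p divides the binomial coefficient because p is
   odd. What remains is (g^p, g^p), which lies on the graph N since [lam] kills g^p. *)
have expY y : y \in X / N -> y ^+ p = 1.
  case/morphimP=> u Nu /XP[g [e [Gg Ee defu]]] ->.
  rewrite -morphX //= coset_id //.
  have [Fgp lgp] := expG g Gg.
  have -> : u ^+ p = (g ^+ p, (g * e) ^+ p).
    by rewrite defu; elim: (p) => // k IHk; rewrite !expgS IHk.
  rewrite !inE /= Fgp lgp mulg1 expMg_Rmul; first last.
  - by apply: commute_sym; apply: cZ; rewrite ?ZR.
  - by apply: commute_sym; apply: cZ; [exact: ZR | exact: (subsetP sEG)].
  have [k ->] : exists k, 'C(p, 2) = (p * k)%N.
    by exists p.-1./2; rewrite bin2odd.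
  rewrite expgM (exponentP expE e Ee) mulg1.
  by rewrite (exponentP expE _ (subsetP sZE _ (ZR e g Ee Gg))) expg1n mulg1 eqxx.
have sYY : [~: X / N, X / N] \subset Z1 / N.
  rewrite -quotientR // quotientSK ?comm_subG //.
  have defNZ : N <*> Z1 = N * Z1 by rewrite norm_joinEr.
  rewrite -defNZ gen_subG; apply/subsetP=> _ /imset2P[u v Xu Xv ->].
  rewrite -[_ \in _]/(_ \in N <*> Z1) defNZ.
  have [z Zz ->] := ZXR u v Xu Xv.
  apply: lamNZ => //; apply: FR.
  - by have [g [e [Gg _ ->]]] := XP u Xu.
  - by have [g [e [Gg _ ->]]] := XP v Xv.
have abM : abelian (M1 / N) by rewrite quotient_abelian ?morphim_abelian.
(* If (g, ge) centralises 1 x E modulo N, each (1, [g,f]) lies in N, which forces g to centralise E.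
   With c supplied by [CGE], all commutators of (g, gc) have the form (x, x lam x), so (g, gc) is
   central modulo N; it differs from (g, ge) by an element of 1 x E. *)
have sCM : 'C_(X / N)(M1 / N) \subset (M1 / N) * 'Z(X / N).
  apply/subsetP=> _ /setIP[/morphimP[u Nu Xu ->]] cMu.
  have [g [e [Gg Ee defu]]] := XP u Xu.
  have Cg : g \in 'C_G(E).
    rewrite inE Gg; apply/centP=> f Ef; apply/commgP.
    have M1f : (1, f) \in M1 by rewrite (mem_morphim (@pair1g_morphism gT gT)) ?inE.
    have: [~ u, (1, f)] \in N.
      have N1f := subsetP nNM1 _ M1f.
      apply: coset_idr; first exact: groupR.
      rewrite morphR //=; apply/eqP/commgP.
      by apply: (centP cMu); rewrite mem_quotient.
    have -> : [~ u, (1, f)] = ([~ g, 1], [~ g * e, 1 * f]) by rewrite defu mul1g.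
    by rewrite RE ?group1 // !commg1 !inE /= lam1 !mulg1 mul1g => /andP[_].
  have [c Ec cE'] := CGE g Cg.
  have Xw := memX g c Gg Ec.
  have Nw := subsetP nNX _ Xw.
  have M1ce : (1, c^-1 * e) \in M1.
    by rewrite (mem_morphim (@pair1g_morphism gT gT)) ?inE // groupM ?groupV.
  have ZY : coset N (g, g * c) \in 'Z(X / N).
    rewrite inE mem_quotient //=; apply/centP=> _ /morphimP[v Nv Xv ->].
    apply/commgP; rewrite -morphR //=; apply/eqP/coset_id.
    have [h [f [Gh Ef ->]]] := XP v Xv.
    have -> : [~ (g, g * c), (h, h * f)] = ([~ g, h], [~ g * c, h * f]) by [].
    have gf1 : [~ g, f] = 1.
      by apply/eqP/commgP; case/setIP: Cg => _ /centP; apply.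
    by rewrite RE // gf1 mul1g cE' // !inE /= FR ?eqxx.
  have [Yw cw] := setIP ZY.
  have M1N : coset N (1, c^-1 * e) \in M1 / N by apply: mem_quotient.
  have XN := subsetP (quotientS N sM1X) _ M1N.
  suff defNu : coset N u = coset N (1, c^-1 * e) * coset N (g, g * c).
    by have := mem_mulg M1N ZY; rewrite -defNu.
  rewrite -(centP cw _ XN) -morphM //; last exact: (subsetP nNM1).
  congr (coset N _); rewrite defu.
  have -> : (g, g * c) * (1, c^-1 * e) = (g * 1, g * c * (c^-1 * e)) by [].
  by rewrite mulg1 -mulgA mulKVg.
have [S [sSY tiSM defY]] := complement_class2 pr_p expY abM
  (quotientS N sM1X) (quotientS N sZM1) oZ1 sYY sCM.
(* The graph of the extension: S * M1/N = X/N makes it total on G, and the trivial intersections of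
   M1/N with S and of M1 with N make it single-valued. *)
pose Gr := (X :&: coset N @*^-1 S)%G.
have GrP u : u \in X -> (u \in Gr) = (coset N u \in S).
  move=> Xu; rewrite in_setI Xu; apply/morphpreP/idP=> [[] // | Su].
  by split; rewrite ?(subsetP nNX).
have Gr_ex g : g \in G -> exists a, (g, a) \in Gr.
  move=> Gg; have Xg : (g, g) \in X by rewrite inE /= Gg mulVg group1.
  have: coset N (g, g) \in S * (M1 / N) by rewrite defY mem_quotient.
  case/mulsgP=> s _ Ss /morphimP[f Nf /morphimP[e _ Ee deff] ->] def_s.
  have Xge := memX g e^-1 Gg (groupVr Ee).
  exists (g * e^-1); rewrite GrP //.
  have -> : (g, g * e^-1) = (g, g) * f^-1.
    have -> : (g, g) * f^-1 = (g * 1^-1, g * e^-1) by rewrite deff.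
    by rewrite invg1 mulg1.
  have Nf1 : f^-1 \in 'N(N) by rewrite groupV.
  have Ng := subsetP nNX _ Xg.
  by rewrite (morphM _ Ng Nf1) (morphV _ Nf) /= def_s mulgK.
have Gr1 a : (1, a) \in Gr -> a = 1.
  move=> Gra; have [Xa _] := setIP Gra; move: Gra; rewrite GrP // => Sa.
  have Ea : a \in E by move: Xa; rewrite inE /= invg1 mul1g => /andP[].
  have M1a : (1, a) \in M1 by rewrite (mem_morphim (@pair1g_morphism gT gT)) ?inE.
  have: (1, a) \in N.
    apply: coset_idr; rewrite ?(subsetP nNX) //; apply/set1gP.
    by rewrite -tiSM inE Sa mem_quotient.
  by rewrite !inE /= lam1 mulg1 => /andP[_ /eqP].
have Gr_uniq g a b : (g, a) \in Gr -> (g, b) \in Gr -> a = b.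
  move=> Ga Gb; have: (g, a) * (g, b)^-1 \in Gr by rewrite groupM ?groupV.
  have -> : (g, a) * (g, b)^-1 = (g * g^-1, a * b^-1) by [].
  by rewrite mulgV => /Gr1/eqP; rewrite -eq_mulgV1 => /eqP.
pose phi g := odflt 1 [pick a | (g, a) \in Gr].
have phiP g : g \in G -> (g, phi g) \in Gr.
  move=> Gg; rewrite /phi; case: pickP => //= no_a.
  by have [a Ga] := Gr_ex g Gg; have := no_a a; rewrite /= Ga.
exists phi; split=> [g h Gg Gh | g Gg | x Fx].
- apply: (Gr_uniq (g * h)); first by apply: phiP; apply: groupM.
  exact: (groupM (phiP g Gg) (phiP h Gh)).
- by have /setIP[] := phiP g Gg; rewrite inE /= => /andP[].
(* The graph contains N, the preimage of the identity, so it agrees with the prescribed twist on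
   F. *)
apply: (Gr_uniq x); first by rewrite phiP ?(subsetP sFG).
have Nx : (x, x * lam x) \in N by rewrite !inE /= Fx eqxx.
by rewrite GrP ?(subsetP sNX) // coset_id.
Qed.

(** A closed form for the iterates of [phi] shows that the p-th one is the identity on G. Hence
    [phi] is bijective there, and its order is p because [lam] is not trivial on F. *)
Lemma aut_of_twist {p : nat} {gT : finGroupType} {G F E Z : {group gT}}
    {lam phi : gT -> gT} :
  prime p -> odd p -> p.-abelem E -> F \subset G -> E \subset F -> Z \subset E ->
  {in F, forall x, lam x \in Z} -> {in Z, forall z, lam z = 1} ->
  {in G &, {morph phi : x y / x * y}} ->
  {in G, forall g, g^-1 * phi g \in E} ->
  {in F, forall x, phi x = x * lam x} ->
  (exists2 x, x \in F & lam x != 1) ->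
  exists2 psi : {perm gT}, psi \in Aut G &
    #[psi] = p /\ {in F, forall x, psi x = x * lam x}.
Proof.
move=> pr_p odd_p abelE sFG sEF sZE lamZ lamZ1 phiM phiE phiF [x0 Fx0 lx0].
have [pE cEE expE] := and3P abelE.
have sEG := subset_trans sEF sFG.
have phiG g : g \in G -> phi g \in G.
  by move=> Gg; rewrite -(mulKVg g (phi g)) groupM // (subsetP sEG) ?phiE.
pose f := Morphism phiM.
(* With d = g^-1 phi(g) and l = lam d, [phi] sends d to dl and fixes l, so the exponents of l add up
   to ['C(k, 2)]. *)
have iterE k g : g \in G ->
    iter k phi g = g * (g^-1 * phi g) ^+ k * lam (g^-1 * phi g) ^+ 'C(k, 2).
  move=> Gg; set d := g^-1 * phi g; have Ed : d \in E := phiE g Gg.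
  have Fd := subsetP sEF d Ed; have Gd := subsetP sFG d Fd.
  have Zl := lamZ d Fd; set l := lam d in Zl *.
  have El := subsetP sZE l Zl; have Gl := subsetP sEG l El.
  elim: k => [|k IHk]; first by rewrite bin0n !mulg1.
  have -> : iter k.+1 phi g = f (iter k phi g) by [].
  rewrite IHk !morphM ?groupM ?groupX // !morphX //=.
  have -> : phi d = d * l by apply: phiF.
  have -> : phi l = l by rewrite phiF ?(subsetP sEF) // lamZ1 // mulg1.
  have -> : phi g = g * d by rewrite mulKVg.
  rewrite expgMn; last exact: (centsP cEE).
  by rewrite binS bin1 expgS (addnC 'C(k, 2)) expgD !mulgA.
have iter_p g : g \in G -> iter p phi g = g.
  move=> Gg; rewrite iterE //; have Ed := phiE g Gg.
  have El := subsetP sZE _ (lamZ _ (subsetP sEF _ Ed)).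
  rewrite (exponentP expE _ Ed) mulg1 bin2odd // expgM.
  by rewrite (exponentP expE _ El) expg1n mulg1.
have injf : 'injm f.
  apply/subsetP=> g /morphpreP[Gg /set1P/= phig1]; apply/set1gP.
  rewrite -(iter_p g Gg); case: (p) (prime_gt0 pr_p) => // k _.
  by rewrite iterSr phig1; elim: k => //= k ->; apply: (morph1 f).
have imf : f @* G = G.
  apply/eqP; rewrite eqEcard (card_injm injf) // leqnn andbT.
  by apply/subsetP=> _ /morphimP[g _ Gg ->]; apply: phiG.
exists (aut injf imf); first exact: Aut_aut.
have autF : {in F, forall x, aut injf imf x = x * lam x}.
  by move=> x Fx; rewrite autE ?(subsetP sFG) //= phiF.
split=> //; apply: nt_prime_order => //.
  apply/permP=> x; rewrite permX perm1.
  have [Gx | notGx] := boolP (x \in G).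
    rewrite -[RHS](iter_p x Gx).
    suff [-> _] : iter p (aut injf imf) x = iter p phi x /\ iter p phi x \in G by [].
    by elim: (p) => [|k [IHk Gk]] //=; rewrite IHk autE ?phiG.
  by elim: (p) => //= k ->; apply: (out_Aut (Aut_aut injf imf)).
apply: contra lx0 => /eqP aut1; have := autF x0 Fx0.
by rewrite aut1 perm1 -{1}[x0]mulg1 => /mulgI <-.
Qed.

(** * The subgroup E and its commutator maps *)

(** Supplies the subgroup E required by [extend_twist]. By [real], D modulo Z(G) is dual to G /
    Phi(G), so the relevant centralisers can be computed by counting with [index_subcent]. *)
Lemma realize_commutators {p : nat} {gT : finGroupType} {G A Z : {group gT}}
    {lam : gT -> gT} :
  prime p -> p.-group G -> abelian A -> A \subset G -> 'Z(G) \subset A ->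
  Z = 'Ohm_1('Z(G)) :> {set gT} -> #|Z| = p ->
  (forall psi : gT -> gT, {in G &, {morph psi : x y / x * y}} ->
     {in G, forall x, psi x \in Z} -> {in 'Phi(G), forall x, psi x = 1} ->
     exists2 h, h \in A & {in G, forall x, [~ x, h] = psi x}) ->
  {in 'Phi(G) &, {morph lam : x y / x * y}} ->
  {in 'Phi(G), forall x, lam x \in Z} ->
  {in G & 'Phi(G), forall g x, lam (x ^ g) = lam x} ->
  exists E : {group gT},
    [/\ p.-abelem E, E \subset A, Z \subset E, [~: E, G] \subset Z
      & E \subset 'C('Phi(G)) /\
        {in 'C_G(E), forall g,
           exists2 e, e \in E & {in G, forall h, [~ e, h] = lam [~ g, h]}}].
Proof.
move=> pr_p pG cAA sAG sZGA defZ oZ real lamM lamZ lamJ.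
have sZZ : Z \subset 'Z(G) by rewrite defZ Ohm_sub.
have cZ z g : z \in Z -> g \in G -> z ^ g = z.
  move=> Zz Gg; have [_ /centP cz] := setIP (subsetP sZZ z Zz).
  by rewrite conjgE cz // mulKg.
have cZ' z g : z \in Z -> g \in G -> commute z g.
  by move=> Zz Gg; apply/commgP/conjg_fixP/cZ.
have Zexp z : z \in Z -> z ^+ p = 1.
  by move=> Zz; apply/eqP; rewrite -order_dvdn -oZ order_dvdG.
have sFG : 'Phi(G) \subset G := Phi_sub G.
have FR g h : g \in G -> h \in G -> [~ g, h] \in 'Phi(G).
  move=> Gg Gh; rewrite (Phi_joing pG).
  by rewrite (subsetP (joing_subl _ _)) // mem_commg.
pose Ds := [set h in A | [forall g in G, [~ h, g] \in Z]].
have Dgroup : group_set Ds.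
  apply/group_setP; split=> [|h k].
    by rewrite inE group1; apply/forall_inP=> g _; rewrite comm1g.
  rewrite !inE => /andP[Ah /forall_inP Zh] /andP[Ak /forall_inP Zk].
  rewrite groupM //; apply/forall_inP=> g Gg.
  rewrite commMgJ (cZ _ k (Zh g Gg) (subsetP sAG k Ak)).
  exact: groupM (Zh g Gg) (Zk g Gg).
pose D := Group Dgroup.
have DP h : reflect (h \in A /\ {in G, forall g, [~ h, g] \in Z}) (h \in D).
  by rewrite inE; apply: (iffP andP) => -[Ah /forall_inP].
move: {Ds Dgroup} D DP => D DP.
have sDA : D \subset A by apply/subsetP=> h /DP[].
have sDG := subset_trans sDA sAG; have cDD := abelianS sDA cAA.
have pD := pgroupS sDG pG.
have sDGZ : [~: D, G] \subset Z.
  by rewrite gen_subG; apply/subsetP=> _ /imset2P[h g /DP[_ Zh] Gg ->]; apply: Zh.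
have sZGD : 'Z(G) \subset D.
  apply/subsetP=> z ZGz; apply/DP; split=> [|g Gg]; first exact: (subsetP sZGA).
  have [_ /centP cz] := setIP ZGz.
  by have /eqP -> : [~ z, g] == 1 by apply/commgP/cz.
have real' psi : {in G &, {morph psi : x y / x * y}} ->
     {in G, forall x, psi x \in Z} -> {in 'Phi(G), forall x, psi x = 1} ->
     exists2 h, h \in D & {in G, forall x, [~ x, h] = psi x}.
  move=> psiM psiZ psi1; have [h Ah hpsi] := real psi psiM psiZ psi1.
  exists h => //; apply/DP; split=> // g Gg.
  by rewrite -invg_comm hpsi // groupV psiZ.
(* Commutators of G are handled by the three subgroup lemma, p-th powers by [g^p, h] = [g, h]^p =
   1. *)
have cFD : 'Phi(G) \subset 'C(D).
  rewrite (Phi_joing pG) join_subG; apply/andP; split.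
    have cGZ : [~: [~: D, G], G] = 1.
      apply/commG1P; apply: subset_trans (subset_trans sDGZ sZZ) _.
      exact: subsetIr.
    by apply/commG1P; apply: three_subgroup => //; rewrite (commGC G D).
  rewrite (MhoE 1 pG) gen_subG; apply/subsetP=> _ /imsetP[g Gg ->].
  apply/centP=> h Dh; apply/commgP; have [_ Zh] := DP h Dh.
  have Zgh : [~ g, h] \in Z by rewrite -invg_comm groupV Zh.
  by rewrite expn1 commXg ?Zexp //; apply/commute_sym/cZ'.
(* For each maximal M, a morphism G -> Z with kernel M is a commutator map [-, h] with h in D; an
   element centralising D is killed by it, hence lies in M. *)
have defCD : 'C_G(D) = 'Phi(G).
  apply/eqP; rewrite eqEsubset andbC subsetI sFG cFD /=.
  apply/subsetP=> g /setIP[Gg cDg]; apply/bigcapP=> M /orP[/eqP-> // | maxM].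
  have nsMG := p_maximal_normal pG maxM.
  have [psi [psiM psiZ psi1]] := hom_of_index_p pr_p nsMG (p_maximal_index pG maxM) oZ.
  have [|h Dh hpsi] := real' psi psiM psiZ.
    by move=> x Fx; apply/eqP; rewrite psi1 ?(subsetP sFG) // (subsetP (Phi_sub_max maxM)).
  rewrite -psi1 // -hpsi //; apply/commgP; exact: (centP cDg).
pose E := 'Ohm_1(D)%G.
have abelE : p.-abelem E := Ohm1_abelem pD cDD.
have [pE cEE expE] := and3P abelE.
have sED : E \subset D := Ohm_sub 1 D.
have sEG := subset_trans sED sDG.
have sZE : Z \subset E by rewrite defZ OhmS.
have sEGZ := subset_trans (commSg G sED) sDGZ.
have sZGG : 'Z(G) \subset G := center_sub G.
have defCDG : 'C_D(G) = 'Z(G).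
  apply/eqP; rewrite eqEsubset setSI //= subsetI sZGD /=.
  exact: subsetIr.
have defCEG : E :&: 'Z(G) = Z.
  apply/eqP; rewrite eqEsubset subsetI sZE sZZ !andbT.
  apply/subsetP=> x /setIP[Ex ZGx]; rewrite defZ (OhmE 1 (pgroupS sZGG pG)).
  by rewrite mem_gen //; apply/LdivP; rewrite expn1 (exponentP expE).
pose L := 'C_G(E)%G.
have sFL : 'Phi(G) \subset L by rewrite subsetI sFG (subset_trans cFD) ?centS.
have sLG : L \subset G by rewrite subsetIl.
have n1 : #|D| = (#|'Z(G)| * (#|G : L| * #|L : 'Phi(G)|))%N.
  rewrite Lagrange_index //= -defCD.
  rewrite (index_subcent pr_p pG pD oZ) 1?commGC // defCDG.
  by rewrite Lagrange.
have n2 : #|E| = (p * #|G : L|)%N.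
  rewrite (index_subcent pr_p pG pE oZ) 1?commGC // -oZ.
  have -> : 'C_E(G) = Z by rewrite -defCEG setIA (setIidPl sEG).
  by rewrite Lagrange.
(* The p-th powers of D are central in G, so |D| = |E| |Mho^1(D)| is at most |E| |Z(G)|; comparison
   with [n1] and [n2] bounds the index by p. *)
have leLF : #|L : 'Phi(G)| <= p.
  have leMho : #|'Mho^1(D)| <= #|'Z(G)|.
    rewrite subset_leq_card // (MhoE 1 pD) gen_subG.
    apply/subsetP=> _ /imsetP[h Dh ->]; rewrite expn1 inE groupX ?(subsetP sDG) //.
    apply/centP=> g Gg; apply/commgP; have [_ Zh] := DP h Dh.
    rewrite commXg ?Zexp ?Zh //; apply: (centsP cDD) => //.
    by rewrite (subsetP sZGD) // (subsetP sZZ) ?Zh.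
  have := mul_card_Ohm_Mho_abelian 1 cDD; rewrite n1 -/E n2 => eqn.
  rewrite -(leq_pmul2l (indexg_gt0 G L)) -(leq_pmul2l (cardG_gt0 'Z(G))) -eqn.
  by rewrite mulnC leq_mul // mulnC.
have nFL : L \subset 'N('Phi(G)) := subset_trans sLG (gFnorm _ _).
have cycLF : cyclic (L / 'Phi(G)).
  apply: (dvdn_prime_cyclic pr_p); rewrite card_quotient //.
  have [k ok] := p_natP (pnat_dvd (dvdn_indexg L 'Phi(G)) (pgroupS sLG pG)).
  by move: leLF; rewrite ok -{2}[p]expn1 leq_exp2l ?prime_gt1 // => /dvdn_exp2l ->.
(* One inclusion is clear; equality follows by comparing orders, since D : C_D(L) and L : Phi(G)
   have the same index and E meets Z(G) in Z. *)
have defCDL : 'C_D(L) = E * 'Z(G).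
  have n3 : #|D : 'C_D(L)| = #|L : 'Phi(G)|.
    rewrite (index_subcent pr_p pD (pgroupS sLG pG) oZ) ?(subset_trans (commgS D sLG)) //.
    suff -> : 'C_L(D) = 'Phi(G) by [].
    by apply/eqP; rewrite eqEsubset subsetI sFL cFD -defCD setSI.
  apply/esym/eqP; rewrite eqEcard mul_subG //=.
  - rewrite -(leq_pmul2r (indexg_gt0 D 'C_D(L))) Lagrange ?subsetIl // n1 n3 mulnA.
    rewrite leq_pmul2r ?indexg_gt0 // -(leq_pmul2r (cardG_gt0 Z)) -{2}defCEG -mul_cardG n2 oZ.
    by rewrite mulnC mulnCA mulnC.
  - by rewrite subsetI sED centsC subsetIr.
  - by rewrite subsetI sZGD (subset_trans _ (centS sLG)) ?subsetIr.
exists E; split=> //; first exact: subset_trans sDA.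
split=> [|g Lg]; first by rewrite centsC (subset_trans cFD) ?centS.
have lam1 : lam 1 = 1.
  by apply: (mulgI (lam 1)); rewrite -lamM ?group1 // !mulg1.
have JF x y : x \in 'Phi(G) -> y \in G -> x ^ y \in 'Phi(G).
  by move=> Fx Gy; rewrite memJ_norm // (subsetP (gFnorm _ _)).
(* An alternating bimultiplicative form on G with values in Z, trivial on Phi(G). *)
pose psi y x := lam [~ x, y].
have psiM y : y \in G -> {in G &, {morph psi y : x z / x * z}}.
  move=> Gy x z Gx Gz; rewrite /psi commMgJ lamM ?lamJ ?FR //.
  by apply: JF => //; apply: FR.
have psiZ y : y \in G -> {in G, forall x, psi y x \in Z}.
  by move=> Gy x Gx; rewrite lamZ ?FR.
have psiF y : y \in G -> {in 'Phi(G), forall x, psi y x = 1}.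
  move=> Gy x Fx; rewrite /psi /commg lamM ?groupV ?JF ?lamJ //.
  by rewrite -lamM ?groupV ?mulVg.
have psiC x y : x \in G -> y \in G -> psi x y = (psi y x)^-1.
  move=> Gx Gy; apply/esym/eqP; rewrite eq_invg_mul /psi -lamM ?FR //.
  by rewrite -(invg_comm y) mulVg lam1.
have psiX y x k : y \in G -> x \in G -> psi y x = 1 -> psi y (x ^+ k) = 1.
  move=> Gy Gx yx1; elim: k => [|k IHk]; first by rewrite expg0 psiF ?group1.
  by rewrite expgS psiM ?groupX // yx1 IHk mulg1.
have [Gg _] := setIP Lg.
have [h Dh hpsi] := real' _ (psiM g Gg) (psiZ g Gg) (psiF g Gg).
(* L / Phi(G) is generated by one element a, and an alternating form vanishes on a cyclic group. So
   [x, h] = psi g x is trivial on L, which puts h in C_D(L) = E Z(G); the factor of h in E is the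
   required element. *)
have ChL : h \in 'C(L).
  have [abar defLF] := cyclicP cycLF.
  have : abar \in L / 'Phi(G) by rewrite defLF cycle_id.
  case/morphimP=> a Na La def_a; have Ga := subsetP sLG a La.
  have sLFa : L \subset 'Phi(G) * <[a]>.
    by rewrite -quotientSK // quotient_cycle // defLF def_a.
  have psia x : x \in L -> psi a x = 1.
    move=> Lx; have /mulsgP[y _ Fy /cycleP[k ->] ->] := subsetP sLFa x Lx.
    rewrite psiM ?groupX ?(subsetP sFG y) // psiF // psiX ?mulg1 //.
    by rewrite /psi commgg.
  apply/centP=> x Lx; apply/commute_sym/commgP.
  have /mulsgP[y _ Fy /cycleP[k ->] ->] := subsetP sLFa x Lx.
  have Gy := subsetP sFG y Fy.
  rewrite hpsi ?groupM ?groupX // psiM ?groupX // psiF // psiX ?mulg1 //.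
  by rewrite psiC // psia // invg1.
have: h \in E * 'Z(G) by rewrite -defCDL inE Dh.
case/mulsgP=> e z Ee ZGz defh; exists e => // x Gx.
have [Gz /centP cz] := setIP ZGz.
have zx1 : [~ z, x] = 1 by apply/eqP/commgP/cz.
have Zex : [~ e, x] \in Z by rewrite (subsetP sEGZ) ?mem_commg.
have -> : [~ e, x] = [~ h, x] by rewrite defh commMgJ zx1 mulg1 cZ.
by rewrite -invg_comm hpsi // psiC // invgK.
Qed.

(** * Choice of [lam] and assembly of the automorphism *)

Theorem theorem4p2 (p : nat) (gT : finGroupType) (G : {group gT})
    (T : nat) (P : nat -> {group gT}) (i : nat) :
  prime p -> odd p ->
  p.-group G -> ~~ abelian G -> cyclic 'Z(G) ->
  'Ohm_1('Z(G)) \subset 'L_3(G) * 'Mho^1(G) ->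
  #|'Phi(G) : 'L_3(G) * 'Mho^1(G)| = (p ^ T)%N -> (1 <= T)%N ->
  P 0%N = 'Phi(G) :> {set gT} ->
  P T = 'L_3(G) * 'Mho^1(G) :> {set gT} ->
  (forall j, (j <= T)%N -> P j <| G) ->
  (forall j, (j < T)%N -> P j.+1 \subset P j) ->
  (forall j, (j < T)%N -> #|P j : P j.+1| = p) ->
  (i < T)%N ->
  'C_G(P i) \subset P i ->
  (forall delta : gT -> gT,
      is_derivation G (P i) 'Ohm_1('Z(P i)) delta -> induced_aut_inner G delta) ->
  exists2 phi : {perm gT}, phi \in Aut G &
    [/\ #[phi] = p,
        forall x, x \in P i.+1 -> phi x = x
      & exists2 x, x \in P i & phi x != x].
Proof.
move=> pr_p odd_p pG nabG cycZ sZN _ _ defP0 defPT nP sP iP lt_iT sCP inner.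
have mono j k : j <= k <= T -> P k \subset P j.
  elim: k => [|k IHk] /andP[]; first by rewrite leqn0 => /eqP->.
  rewrite leq_eqVlt => /predU1P[-> // | le_jk] lt_kT.
  by apply: subset_trans (sP k lt_kT) (IHk _); rewrite -ltnS le_jk ltnW.
have sPF : P i \subset 'Phi(G) by rewrite -defP0 mono //= ltnW.
have sNQ : 'L_3(G) * 'Mho^1(G) \subset P i.+1 by rewrite -defPT mono ?leqnn ?andbT.
have sL3Q := subset_trans (mulG_subl _ _) sNQ.
have sMhoQ := subset_trans (mulG_subr _ _) sNQ.
have [sQG nQG] := andP (nP i.+1 lt_iT).
(* Modulo P_{i+1}, which contains L_3(G) and the p-th powers, Phi(G) is the image of the derived
   subgroup; this makes it central and elementary abelian. *)
have sQP := sP i lt_iT; have sQF := subset_trans sQP sPF.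
have sFG := Phi_sub G; have nQF := subset_trans sFG nQG.
have expQ g : g \in G -> g ^+ p \in P i.+1.
  by move=> Gg; rewrite (subsetP sMhoQ) // (Mho_p_elt 1) ?(mem_p_elt pG).
have sFGQ : [~: 'Phi(G), G] \subset P i.+1.
  have nQ (H : {set gT}) : H \subset G -> H \subset 'N(P i.+1).
    by move=> sHG; apply: subset_trans sHG nQG.
  rewrite -quotient_cents2 // (Phi_joing pG) quotientY ?nQ ?der_sub ?Mho_sub //.
  by rewrite join_subG (quotientS1 sMhoQ) sub1G andbT quotient_cents2 ?nQ ?der_sub.
have abelFQ : p.-abelem ('Phi(G) / P i.+1).
  apply/abelemP=> //; split.
    by rewrite /abelian quotient_cents2 // (subset_trans (commgS _ sFG)).
  move=> _ /morphimP[x Nx Fx ->]; rewrite -morphX //= coset_id //.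
  by rewrite expQ // (subsetP sFG).
(* The kernel K of [lam] is the preimage of a complement of P_i / P_{i+1} in Phi(G) / P_{i+1}: it
   has index p and contains P_{i+1} but not P_i. *)
have := abelem_splits abelFQ (quotientS (P i.+1) sPF).
case/splitsP=> Kq /complP[tiPK defF].
have nsQF : P i.+1 <| 'Phi(G) by rewrite /normal sQF.
have sKqF : Kq \subset 'Phi(G) / P i.+1 by rewrite -defF mulG_subr.
have [K defKq sQK sKF] := inv_quotientS nsQF sKqF.
have nsKF : K <| 'Phi(G).
  rewrite /normal sKF -commg_subr (subset_trans (commgS _ sKF)) //.
  by rewrite (subset_trans (commgS _ sFG)) ?(subset_trans sFGQ).
have oFK : #|'Phi(G) : K| = p.
  apply/eqP; rewrite -(iP i lt_iT) -(eqn_pmul2r (indexg_gt0 K (P i.+1))).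
  rewrite Lagrange_index // -!card_quotient ?(subset_trans _ nQF) // -defKq.
  by rewrite -(TI_cardMg tiPK) defF.
pose Z := 'Ohm_1('Z(G))%G.
have pZG := pgroupS (center_sub G) pG.
have oZ : #|Z| = p.
  apply: Ohm1_cyclic_pgroup_prime => //; apply: contra nabG => /eqP ZG1.
  by rewrite (trivg_center_pgroup pG ZG1) abelian1.
have sZZ : Z \subset 'Z(G) := Ohm_sub 1 _.
have sZQ : Z \subset P i.+1 := subset_trans sZN sNQ.
have cZ : Z \subset 'C(G) := subset_trans sZZ (subsetIr _ _).
have [lam [lamM lamZ lam1]] := hom_of_index_p pr_p nsKF oFK oZ.
have lamQ x : x \in P i.+1 -> lam x = 1.
  by move=> Qx; apply/eqP; rewrite lam1 ?(subsetP sQF) ?(subsetP sQK).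
have lamJ : {in G & 'Phi(G), forall g x, lam (x ^ g) = lam x}.
  move=> g x Gg Fx; have Qxg : [~ x, g] \in P i.+1 by rewrite (subsetP sFGQ) ?mem_commg.
  by rewrite conjg_mulR lamM ?(subsetP sQF _ Qxg) // (lamQ _ Qxg) mulg1.
have sZGA : 'Z(G) \subset 'Z(P i).
  have sZGC : 'Z(G) \subset 'C(P i).
    by rewrite (subset_trans (subsetIr G _)) // centS ?(subset_trans sPF).
  by rewrite subsetI sZGC (subset_trans _ sCP) // subsetI center_sub.
have sAP : 'Z(P i) \subset P i := center_sub _.
have sAF := subset_trans sAP sPF.
(* As Z is central, a morphism into Z is a derivation, so it is x |-> [x, h] for some h in G. It is
   trivial on P_i, so h centralises P_i and then lies in P_i by the hypothesis on C_G(P_i). *)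
have real psi : {in G &, {morph psi : x y / x * y}} ->
    {in G, forall x, psi x \in Z} -> {in 'Phi(G), forall x, psi x = 1} ->
    exists2 h, h \in 'Z(P i) & {in G, forall x, [~ x, h] = psi x}.
  move=> psiM psiZ psi1; have [|h Gh psih] := inner psi.
    split=> [x Gx | x y Gx Gy | x Px].
    - by rewrite (subsetP (OhmS 1 sZGA)) ?psiZ.
    - by rewrite psiM // conjgE (centsP cZ _ (psiZ x Gx) _ Gy) mulKg.
    - by rewrite psi1 ?(subsetP sPF).
  have psiE : {in G, forall x, [~ x, h] = psi x}.
    by move=> x Gx; rewrite commgEl -psih // mulKg.
  exists h => //; have Ch : h \in 'C(P i).
    apply/centP=> x Px; apply/commute_sym/commgP.
    by rewrite psiE ?psi1 ?(subsetP sFG) ?(subsetP sPF).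
  by rewrite inE Ch (subsetP sCP) // inE Gh.
have [E [abelE sEA sZE sEGZ [cFE CGE]]] :=
  realize_commutators pr_p pG (center_abelian (P i)) (subset_trans sAF sFG) sZGA
    (erefl _ : Z = _ :> {set gT}) oZ real lamM lamZ lamJ.
have sEF := subset_trans sEA sAF.
have sGGF : [~: G, G] \subset 'Phi(G) by rewrite (Phi_joing pG) joing_subl.
have expG g : g \in G -> g ^+ p \in 'Phi(G) /\ lam (g ^+ p) = 1.
  by move=> Gg; have Qgp := expQ g Gg; rewrite (subsetP sQF) ?lamQ.
have [phi [phiM phiE phiF]] := extend_twist pr_p odd_p abelE oZ sFG sEF sZE cZ
  cFE sEGZ sGGF lamM lamZ lamJ expG CGE.
have [x Px lx] : exists2 x, x \in P i & lam x != 1.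
  apply/exists_inP; apply: contraT => /exists_inPn lamP.
  have sPK : P i \subset K.
    by apply/subsetP=> x Px; have := lamP x Px; rewrite negbK lam1 ?(subsetP sPF).
  have PQ1 : P i / P i.+1 = 1 by rewrite -tiPK defKq (setIidPl (quotientS _ sPK)).
  have := iP i lt_iT; rewrite -card_quotient ?(subset_trans sPF) // PQ1 cards1.
  by move=> p1; rewrite -p1 in pr_p.
(* The inclusion of Omega_1(Z(G)) in P_{i+1} is what makes [phi] fix the values of [lam]. *)
have lamZ1 : {in Z, forall z, lam z = 1} by move=> z /(subsetP sZQ)/lamQ.
have exl : exists2 x, x \in 'Phi(G) & lam x != 1.
  by exists x; rewrite ?(subsetP sPF).
have [psi Apsi [opsi psiF]] := aut_of_twist pr_p odd_p abelE sFG sEF sZE lamZ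
  lamZ1 phiM phiE phiF exl.
exists psi => //; split=> // [y Qy | ].
  by rewrite psiF ?(subsetP sQF) // lamQ ?mulg1.
exists x => //; rewrite psiF ?(subsetP sPF) //.
by apply: contra lx => /eqP e; rewrite -(mulKg x (lam x)) e mulVg.
Qed.
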